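(* $\mathrm{ex}(n,\{\text{swords},\text{bat},\text{ears},\text{david}\})\in\Theta(n^2)$.
   Context: Let $P$ be a set of $n$ points in convex position in the plane (the vertices of a convex $n$-gon); a triangle on $P$ is a 3-element subset of $P$. For two distinct triangles $t_1,t_2$ on $P$, label each point of $t_1\cup t_2$ by the triangle(s) containing it and read the points in their cyclic order around the polygon. The pair forms exactly one of eight configurations. (i) If $t_1,t_2$ share two vertices $u,v$: ''taco'' if their third vertices lie on the same side of the line $uv$, ''mariposa'' if on opposite sides. (ii) If they share exactly one vertex $v$: read the remaining four vertices in cyclic order starting just after $v$; ''bat'' if the pattern is $t_1t_1t_2t_2$ or $t_2t_2t_1t_1$, ''nested'' if it is $t_1t_2t_2t_1$ or $t_2t_1t_1t_2$, ''crossing'' if it is $t_1t_2t_1t_2$ or $t_2t_1t_2t_1$. (iii) If they share no vertex, the cyclic sequence of the six labels is, up to rotation, reflection and exchanging the roles of $t_1,t_2$, one of: ''ears'' $AAABBB$, ''swords'' $AABABB$, ''david'' $ABABAB$. For a set $X$ of configurations, $\mathrm{ex}(n,X)$ is the maximum size of a family of triangles on $P$ in which no two triangles form a configuration belonging to $X$ (this depends only on $n$ and $X$). *)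

(* Defs.v *)
From HB Require Import structures.
From mathcomp Require Export all_boot all_order all_algebra.
From mathcomp Require Export boolp classical_sets filter reals topology.
From mathcomp Require Export normedtype landau.

Set Implicit Arguments.
Unset Strict Implicit.
Unset Printing Implicit Defensive.

Import Order.TTheory GRing.Theory Num.Theory.
Import numFieldNormedType.Exports.

Local Open Scope ring_scope.

Inductive config : Set :=
  taco | mariposa | bat | nested | crossing | ears | swords | david.

Definition config_code (c : config) : 'I_8 :=
  inord (match c with
         | taco => 0 | mariposa => 1 | bat => 2 | nested => 3
         | crossing => 4 | ears => 5 | swords => 6 | david => 7
         end).

Definition config_decode (i : 'I_8) : config :=
  nth taco [:: taco; mariposa; bat; nested; crossing; ears; swords; david] i.

Lemma config_codeK : cancel config_code config_decode.
Proof. by case; rewrite /config_decode inordK. Qed.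

HB.instance Definition _ := Finite.copy config (can_type config_codeK).

Section Polygon.
Variables (R : realType) (n : nat) (P : 'I_n -> 'rV[R]_2).

(* No point lies in the convex hull of the other ones. *)
Definition convex_position : Prop :=
  forall i : 'I_n, ~ exists w : 'I_n -> R,
    [/\ forall j, 0 <= w j, w i = 0, \sum_j w j = 1
      & P i = \sum_j w j *: P j].

(* Twice the signed area of the triangle with vertices P i, P j, P k: positive
   when they are in counterclockwise order, and, as a function of k, of constant
   sign on each open side of the line through P i and P j. *)
Definition orient (i j k : 'I_n) : R :=
  (P j 0 0 - P i 0 0) * (P k 0 1 - P i 0 1) -
  (P j 0 1 - P i 0 1) * (P k 0 0 - P i 0 0).

(* P lists the vertices of a convex n-gon in counterclockwise order, so that the
   cyclic order around the polygon is the cyclic order of the indices. *)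
Definition convex_polygon : Prop :=
  convex_position /\ forall i j k : 'I_n, (i < j < k)%N -> 0 < orient i j k.

Implicit Types t : {set 'I_n}.

Definition is_triangle t : bool := #|t| == 3.

Definition share2 (q : 'I_n -> 'I_n -> 'I_n -> 'I_n -> bool) t1 t2 : bool :=
  [exists u, exists v, exists a, exists b,
    [&& u != v, t1 :&: t2 == [set u; v], t1 :\: t2 == [set a],
        t2 :\: t1 == [set b] & q u v a b]].

Definition same_side u v a b : bool := 0 < orient u v a * orient u v b.
Definition opposite_side u v a b : bool := orient u v a * orient u v b < 0.

(* The points of A in cyclic order, starting just after v. *)
Definition read_after (v : 'I_n) (A : {set 'I_n}) : seq 'I_n :=
  [seq x <- rot v.+1 (enum 'I_n) | x \in A].

(* Words of labels: true stands for t1 and false for t2. *)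
Definition share1 (ws : seq bitseq) t1 t2 : bool :=
  [exists v, (t1 :&: t2 == [set v]) &&
    ([seq x \in t1 | x <- read_after v ((t1 :|: t2) :\ v)] \in ws)].

(* The words equal to w up to rotation, reflection and exchange of labels. *)
Definition cyclic_class (w : bitseq) : seq bitseq :=
  [seq rot k w' | w' <- [:: w; rev w; map negb w; map negb (rev w)],
                  k <- iota 0 (size w)].

Definition share0 (w : bitseq) t1 t2 : bool :=
  [disjoint t1 & t2] &&
  ([seq x \in t1 | x <- enum (t1 :|: t2)] \in cyclic_class w).

Definition forms (c : config) t1 t2 : bool :=
  match c with
  | taco => share2 same_side t1 t2
  | mariposa => share2 opposite_side t1 t2
  | bat => share1 [:: [:: true; true; false; false];
                      [:: false; false; true; true]] t1 t2
  | nested => share1 [:: [:: true; false; false; true];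
                         [:: false; true; true; false]] t1 t2
  | crossing => share1 [:: [:: true; false; true; false];
                           [:: false; true; false; true]] t1 t2
  | ears => share0 [:: true; true; true; false; false; false] t1 t2
  | swords => share0 [:: true; true; false; true; false; false] t1 t2
  | david => share0 [:: true; false; true; false; true; false] t1 t2
  end.

Definition avoids (X : {set config}) (F : {set {set 'I_n}}) : bool :=
  [forall t1 in F, forall t2 in F, (t1 != t2) ==>
    [forall c in X, ~~ forms c t1 t2]].

Definition ex_tri (X : {set config}) : nat :=
  \max_(F : {set {set 'I_n}} | [forall t in F, is_triangle t] && avoids X F)
    #|F|.

End Polygon.

(* Main.v *)
Require Import Defs.
From mathcomp Require Import zify.
Set Implicit Arguments.
Unset Strict Implicit.
Unset Printing Implicit Defensive.

Import Order.TTheory GRing.Theory Num.Theory.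
Import numFieldNormedType.Exports.
Local Open Scope ring_scope.

(* Every pair of disjoint triangles is an ears, a swords or a david, so an
   avoiding family is intersecting and each member is fixed by a vertex of one
   member t0 and two further points: at most 3 n^2 triangles. Conversely, split
   the points other than the first into two blocks of consecutive points: two
   triangles made of the first point and one point of each block never form a
   bat, because both points of one block precede both points of the other. *)

Local Notation forbidden := [set swords; bat; ears; david].

(** Finite check by enumeration: of the 20 balanced words of length 6, 12 are swords, 6 ears and 2
    david. *)
Lemma balanced_word_in_cyclic_class (w : bitseq) :
  size w = 6 -> count id w = 3 ->
  [|| w \in cyclic_class [:: true; true; false; true; false; false],
      w \in cyclic_class [:: true; true; true; false; false; false]
    | w \in cyclic_class [:: true; false; true; false; true; false]].
Proof. by do 7?[case: w => [//|[] w]] => //; case: w. Qed.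

Section ExtremalBounds.
Variables (R : realType) (n : nat) (P : 'I_n -> 'rV[R]_2).
Implicit Types (t : {set 'I_n}) (F : {set {set 'I_n}}).

Lemma disjoint_triangles_forms t1 t2 :
  is_triangle t1 -> is_triangle t2 -> [disjoint t1 & t2] ->
  [|| forms P swords t1 t2, forms P ears t1 t2 | forms P david t1 t2].
Proof.
move=> /eqP t1_3 /eqP t2_3 t12; rewrite /= /share0 t12 /=.
apply: balanced_word_in_cyclic_class.
  by rewrite size_map -cardE cardsU (disjoint_setI0 t12) cards0 t1_3 t2_3.
rewrite count_map -t1_3 cardE -size_filter.
apply/perm_size/uniq_perm; rewrite ?enum_uniq ?(filter_uniq _ (enum_uniq _)) // => x.
by rewrite mem_filter !mem_enum !inE /=; case: (x \in t1).
Qed.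

Lemma ex_tri_forbidden_le : (ex_tri P forbidden <= 3 * n ^ 2)%N.
Proof.
apply/bigmax_leqP => F /andP[/forall_inP Ftri /forall_inP Fav].
have [->|[t0 t0F]] := set_0Vmem F; first by rewrite cards0.
have meets t : t \in F -> ~~ [disjoint t0 & t].
  move=> tF; apply/negP => t0t.
  (* [avoids] only constrains distinct pairs; a triangle is nonempty, hence not disjoint from
     itself. *)
  have t0_neq : t0 != t.
    apply/eqP => t0E; move: t0t; rewrite -t0E -finset.setI_eq0 finset.setIid -cards_eq0.
    by rewrite (eqP (Ftri _ t0F)).
  have /forall_inP nforms := implyP (forall_inP (Fav _ t0F) _ tF) t0_neq.
  have := disjoint_triangles_forms (Ftri _ t0F) (Ftri _ tF) t0t.
  by rewrite !(negPf (nforms _ _)) // !inE eqxx ?orbT.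
(* The domain has 3 * n ^ 2 elements; repeated or degenerate images are harmless, since the image
   only has to cover [F]. *)
pose join3 (p : 'I_n * ('I_n * 'I_n)) : {set 'I_n} := p.1 |: [set p.2.1; p.2.2].
have sF : F \subset join3 @: finset.setX t0 [set: 'I_n * 'I_n].
  apply/fintype.subsetP => t tF; have := meets t tF.
  rewrite disjoint_sym disjoint_subset => /fintype.subsetPn[x xt].
  rewrite inE negbK => xt0.
  have /cards2P[y [z [_ yz]]] : #|t :\ x| == 2.
    by have /eqP := Ftri _ tF; rewrite (cardsD1 x) xt add1n => -[->].
  apply/imsetP; exists (x, (y, z)); first by rewrite !inE xt0.
  by rewrite /join3 /= -yz finset.setD1K.
apply: leq_trans (subset_leq_card sF) _.
apply: leq_trans (leq_imset_card _ _) _.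
by rewrite cardsX cardsT card_prod card_ord (eqP (Ftri _ t0F)) mulnn.
Qed.

End ExtremalBounds.

Section TwoBlockFamily.
Variables (n m : nat).
Hypothesis m2n : (m + m <= n)%N.

(** Index 0 is the common apex; the blocks are 1..m and m+1..2m, within range because m + m <= n. *)
Definition block_triangle (p : 'I_m * 'I_m) : {set 'I_n.+1} :=
  [set ord0; inord p.1.+1; inord (m + p.2).+1].

Lemma mem_block_triangle p (x : 'I_n.+1) :
  (x \in block_triangle p) =
  [|| x == 0 :> nat, x == p.1.+1 :> nat | x == (m + p.2).+1 :> nat].
Proof.
case: p => i j; rewrite !inE -!val_eqE /= !inordK -?orbA //.
  by have := ltn_ord j; lia.
by have := ltn_ord i; lia.
Qed.

Lemma block_triangle_inj : injective block_triangle.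
Proof.
move=> [i j] [i' j'] eqt.
have memE x := congr1 (fun t : {set 'I_n.+1} => x \in t) eqt.
have [li lj li' lj'] := And4 (ltn_ord i) (ltn_ord j) (ltn_ord i') (ltn_ord j').
(* The blocks are disjoint, so the only vertex of the second triangle that can match is the one in
   the same block. *)
have /esym := memE (inord i.+1); have /esym := memE (inord (m + j).+1).
rewrite !mem_block_triangle /= !inordK ?eqxx ?orbT; try lia.
by move=> ej ei; congr pair; apply: val_inj => /=; lia.
Qed.

Lemma block_triangle_is_triangle p : is_triangle (block_triangle p).
Proof.
case: p => i j; have [li lj] := (ltn_ord i, ltn_ord j).
rewrite /is_triangle /block_triangle /= -finset.setUA cardsU1 cards2 !inE -!val_eqE /=.
by rewrite !inordK; lia.
Qed.

(** Starting just after [ord0] only moves [ord0] to the end, and [A] omits it, so cyclic order is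
    index order. *)
Lemma read_after0_sorted (A : {set 'I_n.+1}) :
  ord0 \notin A -> sorted ltn (map val (read_after ord0 A)).
Proof.
move=> /negPf A0; rewrite /read_after.
have -> : [seq x <- rot 1 (enum 'I_n.+1) | x \in A]
          = [seq x <- enum 'I_n.+1 | x \in A].
  by rewrite enum_ordSl rot1_cons filter_rcons /= A0.
rewrite sorted_map; apply: sorted_filter; first by move=> y x z; apply: ltn_trans.
by rewrite -sorted_map val_enum_ord iota_ltn_sorted.
Qed.

Lemma block_triangle_split p (x y : 'I_n.+1) :
  x \in block_triangle p -> y \in block_triangle p -> (0 < x < y)%N ->
  (x <= m < y)%N.
Proof.
have [lp1 lp2] := (ltn_ord p.1, ltn_ord p.2).
by rewrite !mem_block_triangle; lia.
Qed.

(* In either bat word, the first pair of equal labels is a whole triangle, whose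
   second point lies in the second block, yet it precedes the whole other
   triangle. *)
Lemma block_triangle_no_bat (R : realType) (P : 'I_n.+1 -> 'rV[R]_2) p q :
  ~~ forms P bat (block_triangle p) (block_triangle q).
Proof.
apply/existsP => -[v /andP[/eqP vE]].
(* The apex lies in both triangles, so it is their single common vertex. *)
have v0 : v = ord0.
  by apply/esym/set1P; rewrite -vE inE !mem_block_triangle.
rewrite {v}v0 in vE *.
set A := _ :\ _; have A0 : ord0 \notin A by rewrite !inE.
have := read_after0_sorted A0.
have : {subset read_after ord0 A <= A} by move=> x; rewrite mem_filter => /andP[].
move: (read_after _ _) => s sA s_sorted; rewrite !inE => ws.
have : size s = 4 by case/orP: ws => /eqP /(congr1 size); rewrite size_map.
case: s => [|x1 [|x2 [|x3 [|x4 []]]]] // in sA s_sorted ws * => _.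
move: s_sorted => /= /and4P[x12 x23 x34 _].
have spq x : x \in [:: x1; x2; x3; x4] ->
    (0 < x)%N /\ (x \in block_triangle p) || (x \in block_triangle q).
  by move=> /sA; rewrite finset.in_setD1 finset.in_setU -val_eqE /= lt0n => /andP.
have /spq[x1_gt0 x1pq] : x1 \in [:: x1; x2; x3; x4] by rewrite !inE eqxx.
have /spq[_ x2pq] : x2 \in [:: x1; x2; x3; x4] by rewrite !inE eqxx orbT.
have /spq[x3_gt0 x3pq] : x3 \in [:: x1; x2; x3; x4] by rewrite !inE eqxx !orbT.
have /spq[_ x4pq] : x4 \in [:: x1; x2; x3; x4] by rewrite !inE eqxx !orbT.
have [x12_gt0 x34_gt0] : (0 < x1 < x2)%N /\ (0 < x3 < x4)%N.
  by rewrite x1_gt0 x12 x3_gt0 x34.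
(* Stated for arbitrary [r] and [r'] to serve both bat words, with [p] and [q] in either order. *)
have contra (r r' : 'I_m * 'I_m) :
    x1 \in block_triangle r -> x2 \in block_triangle r ->
    x3 \in block_triangle r' -> x4 \in block_triangle r' -> False.
  move=> x1r x2r x3r x4r.
  have /andP[_ m_lt_x2] := block_triangle_split x1r x2r x12_gt0.
  have /andP[x3_le_m _] := block_triangle_split x3r x4r x34_gt0.
  by have := leq_ltn_trans x3_le_m m_lt_x2; rewrite ltnNge ltnW.
case/orP: ws => /eqP[e1 e2 e3 e4]; move: x1pq x2pq x3pq x4pq;
  by rewrite e1 e2 e3 e4 /=; eauto.
Qed.

Lemma ex_tri_forbidden_ge (R : realType) (P : 'I_n.+1 -> 'rV[R]_2) :
  (m ^ 2 <= ex_tri P forbidden)%N.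
Proof.
have <- : #|block_triangle @: [set: 'I_m * 'I_m]| = (m ^ 2)%N.
  rewrite card_imset ?cardsT ?card_prod ?card_ord ?mulnn //.
  exact: block_triangle_inj.
apply: leq_bigmax_cond; apply/andP; split.
  by apply/forall_inP => _ /imsetP[p _ ->]; apply: block_triangle_is_triangle.
apply/forall_inP => _ /imsetP[p _ ->]; apply/forall_inP => _ /imsetP[q _ ->].
apply/implyP => _; apply/forall_inP => c.
(* The shared apex rules out swords, ears and david at once; only bat remains. *)
have ndisj : [disjoint block_triangle p & block_triangle q] = false.
  by apply/negbTE/pred0Pn; exists ord0; rewrite /= !mem_block_triangle.
rewrite !inE => /orP[/orP[/orP[]|]|] /eqP->; try by rewrite /= /share0 ndisj.
exact: block_triangle_no_bat.
Qed.

End TwoBlockFamily.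

Theorem theorem18 (R : realType) (P : forall n : nat, 'I_n -> 'rV[R]_2)
    (hP : forall n : nat, convex_polygon (P n)) :
  (fun n : nat => (ex_tri (P n) [set swords; bat; ears; david])%:R : R^o)
    \is 'Theta_(\oo%classic) (fun n : nat => n%:R ^+ 2 : R^o).
Proof.
rewrite bigThetaE; split.
  apply/eqO_exP; exists 3; first by rewrite ltr0n.
  near=> n.
  rewrite !ger0_norm ?exprn_ge0 ?ler0n // -natrX -natrM ler_nat.
  exact: ex_tri_forbidden_le.
(* Setting the apex aside leaves blocks of size m = floor((n - 1) / 2); n <= 4m holds from n = 3 on,
   and squaring gives 16. *)
have lower n : (3 <= n)%N -> (n ^ 2 <= 16 * ex_tri (P n) forbidden)%N.
  case: n => // n n2.
  have m2n : (n./2 + n./2 <= n)%N by lia.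
  apply: leq_trans (leq_mul (leqnn 16) (ex_tri_forbidden_ge m2n (P n.+1))).
  by rewrite -(expnMn 4 _ 2) leq_exp2r //; lia.
rewrite eqOmegaO; apply/eqO_exP; exists 16; first by rewrite ltr0n.
near=> n.
rewrite !ger0_norm ?exprn_ge0 ?ler0n // -natrX -natrM ler_nat.
by apply: lower; near: n; apply: nbhs_infty_ge.
Unshelve. all: by end_near. Qed.
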